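(* Let $G$ be a Gaussian process on $[0,1]$ such that $G-\mathbb{E}G$ is stationary with covariance function $K$ satisfying $\|K\|_1<\infty$ and $\|\hat K'\|_\infty<\infty$. Let $\delta\in(0,1)$, $\alpha\in(0,1/2)$ and $\mathcal{C}_{n,\alpha}=[\alpha n,(1-\alpha)n]$. Given $n$ samples of one realization of $G$ at $i/n$, $i=1,\dots,n$, consider the CUSUM test $T_{CUSUM}$ (with threshold $R_{n,\delta}$) described in the context. There are $R_{n,\delta}>0$ and $n_0=n_0(\delta,\alpha)$ such that if $n\ge n_0$ and $$|b|\ge4\sqrt{\frac{\log\left(\frac{2n(1-2\alpha)}{\delta}\right)}{\alpha(1-\alpha)}},$$ then $\varphi_n(T_{CUSUM})\le\delta$.
   Context: Observations: $\boldsymbol X=(X_1,\dots,X_n)^\top$ with $X_k=G(k/n)$, with covariance matrix $[K((r-s)/n)]_{r,s=1}^n$. $\hat K(\omega)=\int_{\mathbb{R}}K(t)e^{-j\omega t}dt$, $\hat K'$ is its derivative, $\|K\|_1=\int_{\mathbb{R}}|K|$, $\|\cdot\|_\infty$ is the sup norm on $\mathbb{R}$. Testing problem: change points $t$ range over the integers in $\mathcal{C}_{n,\alpha}$. Let $\zeta_t\in\mathbb{R}^n$ have $\zeta_t(k)=-1$ for $k\le t$ and $+1$ for $k>t$. The null hypothesis is $\mathbb{H}_0:\mathbb{E}\boldsymbol X=0$; the alternative with change point $t$ and jump $b\ne0$ is $\mathbb{H}_{1,t}:\mathbb{E}\boldsymbol X=\frac b2\zeta_t$ (same covariance). The CUSUM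 test with threshold $R_{n,\delta}$ is $$T_{CUSUM}=\mathbb{1}\left\{\max_{t\in\mathcal{C}_{n,\alpha}}\sqrt{\frac{t(n-t)}n}\left|\frac1{n-t}\sum_{k=t+1}^nX_k-\frac1t\sum_{k=1}^tX_k\right|\ge R_{n,\delta}\right\}.$$ For a test $T\in\{0,1\}$, $\varphi_n(T)=\mathbb{P}(T=1\mid\mathbb{H}_0)+\max_{t\in\mathcal{C}_{n,\alpha}}\mathbb{P}(T=0\mid\mathbb{H}_{1,t})$, where under $\mathbb{H}_{1,t}$ the jump size is $b$.
   Formalization: The sample size threshold n_0 and the threshold R_{n,δ} may depend on the fixed covariance K; an n_0 depending only on δ and α is impossible, as scaling K by a large constant shows. *)

(* Defs.v *)
From HB Require Import structures.
From mathcomp Require Import all_boot all_order all_algebra.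
From mathcomp Require Import complex.
From mathcomp Require Import all_classical all_reals all_analysis.

Set Implicit Arguments.
Unset Strict Implicit.
Unset Printing Implicit Defensive.

Import Order.TTheory GRing.Theory Num.Theory.
Import numFieldNormedType.Exports.

Local Open Scope classical_set_scope.
Local Open Scope ring_scope.

Section fourier.
Context {R : realType}.

Local Open Scope complex_scope.

(* \int K(t) e^{-j w t} dt for real-valued K; the library has no integral of
   complex-valued functions, so real and imaginary parts are separated. *)
Definition fourier (K : R -> R) (w : R) : R[i] :=
  (\int[lebesgue_measure]_t (K t * cos (w * t)))
  -i* (\int[lebesgue_measure]_t (K t * sin (w * t))).

(* The library has no derivative of a complex-valued function of a real
   variable: it is taken componentwise. *)
Definition cderivable (f : R -> R[i]) : Prop :=
  forall w : R, derivable (fun x : R => complex.Re (f x)) w 1 /\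
                derivable (fun x : R => complex.Im (f x)) w 1.

Definition cderive (f : R -> R[i]) (w : R) : R[i] :=
  derive1 (fun x : R => complex.Re (f x)) w +i*
  derive1 (fun x : R => complex.Im (f x)) w.

Definition csupnorm (f : R -> R[i]) : \bar R :=
  ereal_sup (range (fun w => (ComplexField.Normc.normc (f w))%:E)).

End fourier.

Section gaussian_process.
Context {R : realType} {d : measure_display} {T : measurableType d}.
Implicit Types (P : probability T R) (G : R -> T -> R).

(* Degenerate laws are treated apart because [normal_prob m 0] is not the
   Dirac mass at [m]. *)
Definition gaussian_variable P (X : T -> R) : Prop :=
  measurable_fun setT X /\
  ((exists m : R, forall A : set R, measurable A ->
      P (X @^-1` A) = \d_m A) \/
   (exists m s : R, 0 < s /\ forall A : set R, measurable A ->
      P (X @^-1` A) = normal_prob m s A)).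

(* Only the restriction of [G] to the index set [0, 1] is relevant. *)
Definition gaussian_process P G : Prop :=
  forall (m : nat) (s c : 'I_m -> R), (forall i, 0 <= s i <= 1) ->
    gaussian_variable P (fun w => \sum_(i < m) c i * G (s i) w).

(* Covariances are invariant under centering, so this is stationarity of
   G - E G. *)
Definition stationary_covariance P G (K : R -> R) : Prop :=
  forall s t : R, 0 <= s <= 1 -> 0 <= t <= 1 ->
    covariance P (G s) (G t) = (K (s - t))%:E.

(* Coordinate [k : 'I_n] of a vector is its entry number k + 1. *)
Definition samples n G (w : T) : 'rV[R]_n :=
  \row_(k < n) G (k.+1%:R / n%:R) w.

Definition has_mean n P (X : T -> 'rV[R]_n) (mu : 'rV[R]_n) : Prop :=
  forall k : 'I_n, 'E_P[fun w => X w ord0 k]%E = (mu ord0 k)%:E.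

End gaussian_process.

Section testing.
Context {R : realType}.

Definition zeta n (t : nat) : 'rV[R]_n :=
  \row_(k < n) (if (k.+1 <= t)%N then -1 else 1).

Definition change_points n (alpha : R) : pred nat :=
  fun t => (alpha * n%:R <= t%:R) && (t%:R <= (1 - alpha) * n%:R).

Definition cusum_stat n (x : 'rV[R]_n) (t : nat) : R :=
  Num.sqrt (t%:R * (n%:R - t%:R) / n%:R) *
  `| (n%:R - t%:R)^-1 * (\sum_(k < n | (t < k.+1)%N) x ord0 k)
     - t%:R^-1 * (\sum_(k < n | (k.+1 <= t)%N) x ord0 k) |.

(* Statistics are nonnegative, so the neutral element 0 is harmless. *)
Definition cusum_test n (alpha r : R) (x : 'rV[R]_n) : bool :=
  r <= \big[Num.max/0]_(t < n.+1 | change_points n alpha t) cusum_stat x t.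

Definition testing_risk {d : measure_display} {T : measurableType d} n
    (alpha : R) (X : T -> 'rV[R]_n) (P0 : probability T R)
    (P1 : nat -> probability T R) (test : 'rV[R]_n -> bool) : \bar R :=
  (P0 [set w | test (X w) = true] +
   \big[maxe/0]_(t < n.+1 | change_points n alpha t)
     P1 t [set w | test (X w) = false])%E.

End testing.

(* Main.v *)
Require Import Defs.
From HB Require Import structures.
From mathcomp Require Import all_boot all_order all_algebra.
From mathcomp Require Import complex ring lra.
From mathcomp Require Import all_classical all_reals all_analysis.
From mathcomp Require Import measurable_realfun.

Set Implicit Arguments.
Unset Strict Implicit.
Unset Printing Implicit Defensive.

Import Order.TTheory GRing.Theory Num.Theory.
Import numFieldNormedType.Exports.

Local Open Scope classical_set_scope.
Local Open Scope ring_scope.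


(** The CUSUM statistic at a change point is the absolute value of the inner
    product of the data with a unit vector, so its square is at most the energy
    [\sum_k x_k ^+ 2] of the data, for every change point at once
    ([cusum_stat_sqr_le]).  The centered samples have expected energy
    [n * K 0], and Markov's inequality for this one random variable
    ([centered_samples_tail]) shows that all the
    noise statistics stay below [r n = sqrt (M * (n + 1))], with
    [M = 2 * (1 + |K 0|) / delta], outside an event of probability at most
    [delta / 2].

    Under the null hypothesis a false alarm lies in that event.  Under the
    alternative at [t], the noise-free statistic is
    [sqrt (t * (n - t) / n) * |b|] ([cusum_stat_zeta]), which is at least
    [sqrt (alpha * (1 - alpha) * n) * |b|], hence at least [4 * sqrt (n * L)]
    with [L = ln (2 * n * (1 - 2 * alpha) / delta)].  As [L] tends to infinity,
    [M <= L] for [n] large, and then the signal is at least [2 * r n]; by the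
    triangle inequality a missed detection forces the noise statistic at [t]
    above [r n], which again has probability at most [delta / 2].  The
    logarithmic growth of the signal is what absorbs the scale [K 0] of the
    noise, and is why the sample size threshold depends on [K 0]. *)

(** * The CUSUM statistic as a projection *)

Section cusum.
Context {R : realType}.
Implicit Types (n t : nat).

(** Cauchy-Schwarz against the constant 1, read off from the nonnegative sum of
    squared deviations from the mean; the cardinal is kept as a sum so that it
    lives in [R]. *)
Lemma sqr_sum_le_card (I : finType) (P : pred I) (F : I -> R) :
  (\sum_(i | P i) F i) ^+ 2
    <= (\sum_(i | P i) 1) * \sum_(i | P i) F i ^+ 2.
Proof.
set c := \sum_(i | P i) 1; set s := \sum_(i | P i) F i.
set q := \sum_(i | P i) F i ^+ 2.
have c0 : 0 <= c by apply: sumr_ge0.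
have q0 : 0 <= q by apply: sumr_ge0 => i _; exact: sqr_ge0.
have expand (m : R) : 0 <= q - 2 * m * s + m ^+ 2 * c.
  have -> : q - 2 * m * s + m ^+ 2 * c = \sum_(i | P i) (F i - m) ^+ 2.
    rewrite /q /s /c !mulr_sumr -sumrB -big_split /=.
    by apply: eq_bigr => i _; ring.
  by apply: sumr_ge0 => i _; exact: sqr_ge0.
have [c_eq0|c_neq0] := eqVneq c 0.
  (* an empty index set: every sum vanishes *)
  have P0 i : ~~ P i.
    apply/negP => Pi; have := oner_neq0 R; apply/negP; rewrite negbK.
    have : \sum_(i | P i) (1 : R) == 0 by rewrite -/c c_eq0.
    by rewrite psumr_eq0// => /allP/(_ i (mem_index_enum i)); rewrite Pi.
  by rewrite /s big_pred0 ?expr0n ?c_eq0 ?mul0r// => i; exact: negbTE.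
have c_gt0 : 0 < c by rewrite lt_def c_neq0.
have := expand (s / c).
rewrite (_ : _ + _ = (c * q - s ^+ 2) / c); last by field.
by rewrite pmulr_lge0 ?invr_gt0// subr_ge0.
Qed.

Lemma sum_upto n t : (t <= n)%N ->
  \sum_(k < n | (k.+1 <= t)%N) (1 : R) = t%:R.
Proof.
move=> tn; rewrite (eq_bigl (fun k : 'I_n => (k < t)%N))//.
by rewrite -(big_ord_widen _ (fun=> 1 : R) tn) sumr_const card_ord.
Qed.

Lemma sum_after n t : (t <= n)%N ->
  \sum_(k < n | (t < k.+1)%N) (1 : R) = n%:R - t%:R.
Proof.
move=> tn; rewrite -(sum_upto tn) -[n in n%:R]card_ord -sumr_const.
rewrite [in RHS](bigID (fun k : 'I_n => (k.+1 <= t)%N))/= addrAC subrr add0r.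
by apply: eq_bigl => k; rewrite -ltnNge.
Qed.

(** Cauchy-Schwarz for two groups of sizes [u] and [v] with totals [a] and [b]:
    the two sides differ by [n] times the square of the grand mean. *)
Lemma between_group_sqr_le (n u v a b : R) : 0 < u -> 0 < v -> n = v + u ->
  v * u / n * (u^-1 * a - v^-1 * b) ^+ 2 <= b ^+ 2 / v + a ^+ 2 / u.
Proof.
move=> u0 v0 ->; have vu0 : 0 < v + u by rewrite addr_gt0.
rewrite -subr_ge0 (_ : _ - _ = (a + b) ^+ 2 / (v + u)).
  by rewrite divr_ge0 ?sqr_ge0// ltW.
by field; rewrite !gt_eqF.
Qed.

(** The weights of the statistic form a unit vector; the bound on the right is
    free of [t], which is what controls the maximum over change points. *)
Lemma cusum_stat_sqr_le n t (x : 'rV[R]_n) : (0 < t < n)%N ->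
  cusum_stat x t ^+ 2 <= \sum_k x ord0 k ^+ 2.
Proof.
case/andP=> t0 tn; have t0R : 0 < t%:R :> R by rewrite ltr0n.
have u0R : 0 < n%:R - t%:R :> R by rewrite subr_gt0 ltr_nat.
rewrite /cusum_stat exprMn sqr_sqrtr; last first.
  by rewrite divr_ge0// mulr_ge0// ltW.
rewrite real_normK ?num_real// [leRHS](bigID (fun k : 'I_n => (k.+1 <= t)%N))/=.
have := sqr_sum_le_card (fun k : 'I_n => (k.+1 <= t)%N) (x ord0).
have := sqr_sum_le_card (fun k : 'I_n => (t < k.+1)%N) (x ord0).
rewrite (sum_upto (ltnW tn)) (sum_after (ltnW tn)).
under [X in _ <= _ + X]eq_bigl do rewrite -ltnNge.
set a := \sum_(k < n | (t < k.+1)%N) x ord0 k.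
set b := \sum_(k < n | (k.+1 <= t)%N) x ord0 k.
set A := \sum_(k < n | (t < k.+1)%N) _; set B := \sum_(k < n | (k.+1 <= t)%N) _.
move=> aA bB.
have nE : n%:R = t%:R + (n%:R - t%:R) :> R by rewrite addrC subrK.
apply: le_trans (between_group_sqr_le a b u0R t0R nE) _.
by apply: lerD; rewrite ler_pdivrMr// mulrC.
Qed.

(** The statistic is a seminorm; in this form it bounds the signal by the
    observed statistic plus the noise. *)
Lemma cusum_stat_le_add n t (x m : 'rV[R]_n) :
  cusum_stat m t <= cusum_stat x t + cusum_stat (x - m) t.
Proof.
rewrite /cusum_stat -mulrDr ler_wpM2l ?sqrtr_ge0//.
under [X in _ <= _ + `|_ * X - _|]eq_bigr do rewrite !mxE.
under [X in _ <= _ + `|_ - _ * X|]eq_bigr do rewrite !mxE.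
rewrite !sumrB -[X in _ <= _ + X]normrN; apply: le_trans (ler_normD _ _).
by rewrite le_eqVlt; apply/orP; left; apply/eqP; congr `| _ |; ring.
Qed.

Lemma cusum_stat_zeta n t (b : R) : (0 < t < n)%N ->
  cusum_stat ((b / 2) *: zeta n t) t
    = Num.sqrt (t%:R * (n%:R - t%:R) / n%:R) * `|b|.
Proof.
case/andP=> t0 tn; have t0R : t%:R != 0 :> R by rewrite pnatr_eq0 -lt0n.
have u0R : n%:R - t%:R != 0 :> R by rewrite subr_eq0 eqr_nat gtn_eqF.
rewrite /cusum_stat; congr (_ * `|_|).
rewrite (eq_bigr (fun=> b / 2 * 1)); last first.
  by move=> k tk; rewrite !mxE leqNgt tk.
rewrite [X in _ - _ * X](eq_bigr (fun=> - (b / 2) * 1)); last first.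
  by move=> k kt; rewrite !mxE kt mulrN1 mulr1.
rewrite -!mulr_sumr sum_upto ?(ltnW tn)// sum_after ?(ltnW tn)//.
by field; rewrite t0R u0R.
Qed.

(** The concave weight [t * (n - t)] on [[alpha * n, (1 - alpha) * n]] is smallest
    at the endpoints. *)
Lemma change_points_proportion n t (alpha : R) : 0 < alpha -> (0 < n)%N ->
  change_points n alpha t ->
  (0 < t < n)%N /\ alpha * (1 - alpha) * n%:R <= t%:R * (n%:R - t%:R) / n%:R.
Proof.
move=> a0 n0 /andP[lo hi]; have n0R : 0 < n%:R :> R by rewrite ltr0n.
have an0 : 0 < alpha * n%:R by rewrite mulr_gt0.
split.
  by rewrite -(ltr0n R) -(ltr_nat R) (lt_le_trans an0)//=; lra.
rewrite ler_pdivlMr// -subr_ge0.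
rewrite (_ : _ - _ =
  (t%:R - alpha * n%:R) * ((1 - alpha) * n%:R - t%:R)); last by ring.
by rewrite mulr_ge0// subr_ge0.
Qed.

End cusum.

(** * Tail of the noise energy *)

Section probability.
Context {R : realType} {d : measure_display} {T : measurableType d}.

(** The one-point linear combinations are Gaussian variables, hence
    measurable. *)
Lemma gaussian_process_measurable (P : probability T R) (G : R -> T -> R) s :
  gaussian_process P G -> 0 <= s <= 1 -> measurable_fun setT (G s).
Proof.
move=> gG s01; have [+ _] := gG 1%N (fun=> s) (fun=> 1) (fun=> s01).
by under eq_fun do rewrite big_ord1 mul1r.
Qed.

Lemma measurable_cusum_test n (alpha r : R) (X : T -> 'rV[R]_n) :
  (forall k, measurable_fun setT (fun w => X w ord0 k)) ->
  measurable_fun setT (fun w => cusum_test alpha r (X w)).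
Proof.
move=> mX; apply: measurable_fun_ler => //.
have mS (Q : pred 'I_n) :
    measurable_fun setT (fun w => \sum_(k < n | Q k) X w ord0 k).
  under eq_fun do rewrite big_mkcond/=.
  by apply: measurable_sum => k; case: (Q k).
have mstat t : measurable_fun setT (fun w => cusum_stat (X w) t).
  apply: measurable_funM => //; apply: measurableT_comp => //.
  by apply: measurable_funB; apply: measurable_funM.
elim: (index_enum _) => [|t s IH].
  by under eq_fun do rewrite big_nil; exact: measurable_cst.
under eq_fun do rewrite big_cons.
by case: (change_points n alpha t) => //; exact: measurable_maxr.
Qed.

(** Markov's inequality for the energy, whose mean is additive over dependent
    coordinates. *)
Lemma sum_sqr_tail n (P : probability T R) (Y : T -> 'rV[R]_n) (v a : R) :
  (forall k, measurable_fun setT (fun w => Y w ord0 k)) ->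
  (forall k, 'E_P[fun w => (Y w ord0 k ^+ 2)%R] = v%:E)%E -> 0 < a ->
  (P [set w | (a <= \sum_k Y w ord0 k ^+ 2)%R] <= (n%:R * v / a)%:E)%E.
Proof.
move=> mY EY a0.
have mQ k : measurable_fun setT (fun w => Y w ord0 k ^+ 2).
  exact: measurable_funX.
rewrite mulrC EFinM -lee_pdivrMl// ?invr_gt0// invrK.
have mS : measurable_fun setT (fun w => \sum_k Y w ord0 k ^+ 2).
  exact: measurable_sum.
have S0 w : (0 <= \sum_k Y w ord0 k ^+ 2)%R.
  by apply: sumr_ge0 => k _; exact: sqr_ge0.
have := @le_integral_comp_abse _ _ _ P setT measurableT
  (fun w => (\sum_k Y w ord0 k ^+ 2)%:E) a id.
rewrite setTI => /(_ _ _ _ _ a0) markovS.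
have integralS : (\int[P]_w `|(\sum_k (Y w ord0 k ^+ 2)%R)%:E| = (n%:R * v)%:E)%E.
  under eq_integral => w _ do rewrite gee0_abs ?lee_fin// -sumEFin.
  rewrite ge0_integral_sum//; last 2 first.
    by move=> k; exact/measurable_EFinP.
    by move=> k w _; rewrite lee_fin sqr_ge0.
  rewrite (eq_bigr (fun=> v%:E)) => [|k _]; last by rewrite -(EY k) unlock.
  by rewrite sumEFin sumr_const card_ord mulr_natl.
rewrite -integralS; apply: le_trans (markovS _ _ _ _) => //.
  rewrite le_eqVlt; apply/orP; left; apply/eqP; congr (_ * P _)%E.
  by apply/seteqP; split => w /=; rewrite ger0_norm// lee_fin.
exact/measurable_EFinP.
Qed.

Lemma sample_point01 n (k : 'I_n) : 0 <= (k.+1%:R / n%:R : R) <= 1.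
Proof.
have n0 : (0 < n)%N by exact: leq_trans (ltn_ord k).
by rewrite divr_ge0//= ler_pdivrMr ?ltr0n// mul1r ler_nat.
Qed.

Lemma measurable_samples n (P : probability T R) (G : R -> T -> R) k :
  gaussian_process P G -> measurable_fun setT (fun w => samples n G w ord0 k).
Proof.
move=> gG; under eq_fun do rewrite mxE.
exact: gaussian_process_measurable gG (sample_point01 k).
Qed.

Lemma centered_samples_second_moment n (P : probability T R)
    (G : R -> T -> R) (K : R -> R) (m : 'rV[R]_n) k :
  stationary_covariance P G K -> has_mean P (samples n G) m ->
  ('E_P[fun w => ((samples n G w - m) ord0 k ^+ 2)%R] = (K 0)%:E)%E.
Proof.
move=> cG mG.
have := cG _ _ (sample_point01 k) (sample_point01 k); rewrite subrr => <-.
have EG : ('E_P[G (k.+1%:R / n%:R)%R] = (m ord0 k)%:E)%E.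
  by rewrite -mG; congr expectation; apply/funext => w; rewrite mxE.
rewrite [in RHS]unlock EG/=; congr expectation; apply/funext => w.
by rewrite !mxE expr2.
Qed.

Lemma centered_samples_tail n (P : probability T R) (G : R -> T -> R)
    (K : R -> R) (m : 'rV[R]_n) (a : R) :
  gaussian_process P G -> stationary_covariance P G K ->
  has_mean P (samples n G) m -> 0 < a ->
  (P [set w | (a <= \sum_k (samples n G w - m) ord0 k ^+ 2)%R]
     <= (n%:R * K 0 / a)%:E)%E.
Proof.
move=> gG cG mG; apply: sum_sqr_tail => k.
  under eq_fun do rewrite !mxE.
  apply: measurable_funB => //.
  by have := measurable_samples k gG; under eq_fun do rewrite mxE.
exact: centered_samples_second_moment cG mG.
Qed.

End probability.

(** * The risk bound *)

Theorem theorem5p1 (R : realType) (K : R -> R) (delta alpha : R)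
    (K_L1 : (@lebesgue_measure R).-integrable [set: R] (EFin \o K))
    (hatK_diff : cderivable (fourier K))
    (hatK'_bounded : (csupnorm (cderive (fourier K)) < +oo)%E)
    (delta01 : 0 < delta < 1)
    (alpha012 : 0 < alpha < 1 / 2) :
  exists (r : nat -> R) (n0 : nat),
    (forall n : nat, 0 < r n) /\
    forall (n : nat) (b : R), (n0 <= n)%N -> b != 0 ->
    4 * Num.sqrt (ln (2 * n%:R * (1 - 2 * alpha) / delta)
                  / (alpha * (1 - alpha))) <= `|b| ->
    forall (d : measure_display) (T : measurableType d) (G : R -> T -> R)
      (P0 : probability T R) (P1 : nat -> probability T R),
    (gaussian_process P0 G /\ stationary_covariance P0 G K /\
     has_mean P0 (samples n G) 0) ->
    (forall t : nat, change_points n alpha t ->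
       gaussian_process (P1 t) G /\ stationary_covariance (P1 t) G K /\
       has_mean (P1 t) (samples n G) ((b / 2) *: zeta n t)) ->
    (testing_risk alpha (samples n G) P0 P1 (cusum_test alpha (r n))
       <= delta%:E)%E.
Proof.
have /andP[d0 d1] := delta01; have /andP[a0 a1] := alpha012.
(* [K 0 / M] is at most [delta / 2]; the summand 1 keeps [M] positive *)
pose M : R := 2 * (1 + `|K 0|) / delta.
have M0 : 0 < M by rewrite divr_gt0// mulr_gt0// ltr_pwDl.
(* [n.+1] rather than [n] so that the threshold is positive at [n = 0] *)
pose r n : R := Num.sqrt (M * n.+1%:R).
have r0 n : 0 < r n by rewrite sqrtr_gt0 mulr_gt0.
have r2 n : r n ^+ 2 = M * n.+1%:R by rewrite sqr_sqrtr// mulr_ge0// ltW.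
(* chosen so that [M <= ln (2 * n * (1 - 2 * alpha) / delta)] from [n0] on *)
pose n0 := (Num.truncn (delta * expR M / (2 * (1 - 2 * alpha)))).+1.
exists r, n0; split=> // n b n0n _ bL d T G P0 P1 [g0 [c0 m0]] H1.
have n_gt0 : (0 < n)%N by exact: leq_trans n0n.
pose event (m : 'rV[R]_n) (a : R) := [set w : T |
  (a <= \sum_k (samples n G w - m) ord0 k ^+ 2)%R].
have tail (P : probability T R) m : gaussian_process P G ->
    stationary_covariance P G K -> has_mean P (samples n G) m ->
    (P (event m (r n ^+ 2)%R) <= (delta / 2)%:E)%E.
  move=> gP cP mP; apply: le_trans (centered_samples_tail gP cP mP _) _.
    by rewrite exprn_gt0.
  rewrite lee_fin r2 ler_pdivrMr ?(mulr_gt0 M0)//.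
  have -> : delta / 2 * (M * n.+1%:R) = (1 + `|K 0|) * n.+1%:R.
    by rewrite /M; field; rewrite gt_eqF.
  have := ler_norm (K 0); have := normr_ge0 (K 0).
  have : 0 <= n%:R :> R by [].
  rewrite -natr1; nra.
have mevent m a : measurable (event m a).
  rewrite /event -[X in measurable X]setTI; apply: measurable_fun_le => //.
  apply: measurable_sum => k; apply: measurable_funX.
  under eq_fun do rewrite !mxE.
  apply: measurable_funB => //.
  by have := measurable_samples k g0; under eq_fun do rewrite mxE.
have mtest c : measurable [set w | cusum_test alpha (r n) (samples n G w) = c].
  rewrite -[X in measurable X]setTI.
  have mX k := measurable_samples k g0 (n := n).
  have mc : measurable [set c] by [].
  exact: (measurable_cusum_test alpha (r n) mX measurableT mc).
rewrite /testing_risk (splitr delta) EFinD; apply: leeD.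
  apply: le_trans (tail P0 0 g0 c0 m0); apply: le_measure; rewrite ?inE//.
  move=> w /= /bigmax_geP[|[t /(change_points_proportion a0 n_gt0)[tn _] rS]].
    by rewrite leNgt r0.
  rewrite /event /= subr0; apply: le_trans (cusum_stat_sqr_le _ tn).
  by rewrite lerXn2r// nnegrE ltW// (lt_le_trans (r0 n)).
apply/bigmax_leP; split=> [|t ct]; first by rewrite lee_fin divr_ge0// ltW.
have [g1 [c1 m1]] := H1 t ct.
apply: le_trans (tail _ _ g1 c1 m1); apply: le_measure; rewrite ?inE//.
move=> w /= /negbT; rewrite -ltNge => /bigmax_ltP[_ /(_ t ct) Sr].
have [tn signal] := change_points_proportion a0 n_gt0 ct.
apply: le_trans (cusum_stat_sqr_le _ tn).
rewrite lerXn2r// ?nnegrE ?(ltW (r0 n))//; first by rewrite mulr_ge0// sqrtr_ge0.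
(* half of the signal is the margin left to the noise *)
suff : 2 * r n <= cusum_stat ((b / 2) *: zeta n t) t.
  have := cusum_stat_le_add t (samples n G w) ((b / 2) *: zeta n t); lra.
rewrite cusum_stat_zeta//.
set L := ln _ in bL.
have ML : M <= L.
  rewrite -ler_expR lnK; last first.
    rewrite posrE divr_gt0// !mulr_gt0// ?ltr0n//; lra.
  rewrite ler_pdivlMr// mulrC.
  have nx : delta * expR M / (2 * (1 - 2 * alpha)) <= n%:R.
    apply/ltW/(lt_le_trans (truncnS_gt _)); by rewrite ler_nat.
  rewrite ler_pdivrMr in nx; last by lra.
  by apply: le_trans nx _; rewrite le_eqVlt; apply/orP; left; apply/eqP; ring.
have aa0 : 0 < alpha * (1 - alpha) by rewrite mulr_gt0//; lra.
have L0 : 0 <= L by rewrite (le_trans _ ML)// ltW.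
have n0R : 0 < n%:R :> R by rewrite ltr0n.
apply: le_trans (ler_pM _ _ (ler_wsqrtr signal) bL); rewrite ?mulr_ge0 ?sqrtr_ge0//.
have nL0 : 0 <= n%:R * L by rewrite mulr_ge0.
rewrite mulrCA -sqrtrM; last by rewrite mulr_ge0// ltW.
have -> : alpha * (1 - alpha) * n%:R * (L / (alpha * (1 - alpha))) = n%:R * L.
  have := gt_eqF aa0; rewrite mulf_eq0 => /negbT; rewrite negb_or => aN0.
  by field; rewrite andbC.
suff : r n <= 2 * Num.sqrt (n%:R * L) by lra.
rewrite -(ler_pXn2r (n := 2))// ?nnegrE ?(ltW (r0 n)) ?mulr_ge0 ?sqrtr_ge0//.
rewrite exprMn r2 sqr_sqrtr//.
have n1 : 1 <= n%:R :> R by rewrite ler1n.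
rewrite -natr1; nra.
Qed.
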